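(* Let $d\ge 1$. For each $i=1,\dots,d$ let $k_i\ge 1$, $b_i\geq 1$, $n_i\ge 1$ be integers, $A_i\in\mathbb{C}^{n_i\times n_i}$, $C_i\in\mathbb{C}^{n_i\times b_i}$, and let $\boldsymbol{\xi}_i$ be a sequence of $k_i$ poles in $(\mathbb{C}\cup\{\infty\})\setminus\Lambda(A_i)$. Let $\boldsymbol{k}=(k_1,\dots,k_d)$, $\beta=b_1\cdots b_d$, and $Q_i(x)=\prod_{\xi\in\boldsymbol{\xi}_i,\ \xi\ne\infty}(x-\xi)$. Then $$\mathcal{Q}^{\otimes}_{\boldsymbol{k}}(\{A_i\}_i,\{C_i\}_i,\{\boldsymbol{\xi}_i\}_i)=\left\{ r(A_1,\dots,A_d)\circ(C_1,\dots,C_d)\ :\ r(x_1,\dots,x_d)=\frac{P(x_1,\dots,x_d)}{Q_1(x_1)\cdots Q_d(x_d)}\right\},$$ where $P$ ranges over all polynomials in $d$ variables with coefficients in $\mathbb{C}^{\beta\times\beta}$ whose degree in $x_i$ is at most $k_i-1$ for every $i=1,\dots,d$.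
   Context: $\Lambda(A)$ denotes the spectrum of $A$ and $\otimes$ the Kronecker product of matrices. Univariate operator $\circ$: for a matrix polynomial $P(z)=\sum_{j} z^j\Gamma_j$ with $\Gamma_j\in\mathbb{C}^{b\times b}$, a scalar polynomial $Q$ with no zeros in $\Lambda(A)$, $A\in\mathbb{C}^{n\times n}$ and $v\in\mathbb{C}^{n\times b}$, set $P(A)\circ v=\sum_j A^j v\,\Gamma_j$ and, for $R=P/Q$, $R(A)\circ v=Q(A)^{-1}\,(P(A)\circ v)$. Block rational Krylov subspace: for $A\in\mathbb{C}^{n\times n}$, $v\in\mathbb{C}^{n\times b}$ and a sequence $\boldsymbol{\xi}$ of $k$ poles (repetitions allowed, products over poles counted with repetition) in $(\mathbb{C}\cup\{\infty\})\setminus\Lambda(A)$, $$\mathcal{Q}_k(A,v,\boldsymbol{\xi})=\left\{R(A)\circ v:\ R(z)=\frac{P(z)}{Q(z)},\ P \text{ a polynomial of degree at most } k-1 \text{ with coefficients in } \mathbb{C}^{b\times b}\right\},\quad Q(z)=\prod_{\xi\in\boldsymbol{\xi},\,\xi\neq\infty}(z-\xi).$$ It is a subset of $\mathbb{C}^{n\times b}$. Tensorized block rational Krylov subspace: let $W=\{w_1\otimes\cdots\otimes w_d:\ w_i\in\mathcal{Q}_{k_i}(A_i,C_i,\boldsymbol{\xi}_i)\}$. Then $$\mathcal{Q}^{\otimes}_{\boldsymbol{k}}(\{A_i\}_i,\{C_i\}_i,\{\boldsymbol{\xi}_i\}_i)=\left\{\sum_{j=1}^s v_j\Gamma_j:\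 s\in\mathbb{N},\ v_j\in W,\ \Gamma_j\in\mathbb{C}^{b_1\cdots b_d\times b_1\cdots b_d}\right\}.$$ Multivariate operator $\circ$: for $P(x_1,\dots,x_d)=\sum_{I=(i_1,\dots,i_d)}\Gamma_I x_1^{i_1}\cdots x_d^{i_d}$ (finite sum) with $\Gamma_I\in\mathbb{C}^{b_1\cdots b_d\times b_1\cdots b_d}$, $$P(A_1,\dots,A_d)\circ(C_1,\dots,C_d)=\sum_{I}\left(A_1^{i_1}C_1\otimes\cdots\otimes A_d^{i_d}C_d\right)\Gamma_I,$$ and for $R=P/(Q_1(x_1)\cdots Q_d(x_d))$ with scalar polynomials $Q_i$ having no zeros in $\Lambda(A_i)$, $$R(A_1,\dots,A_d)\circ(C_1,\dots,C_d)=\left(Q_1(A_1)^{-1}\otimes\cdots\otimes Q_d(A_d)^{-1}\right)\left(P(A_1,\dots,A_d)\circ(C_1,\dots,C_d)\right).$$ *)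

(* Defs.v *)
From mathcomp Require Import all_boot all_order all_algebra.
From mathcomp Require Import complex mxtens.
From mathcomp Require Import classical_sets reals.
From mathcomp Require Import finmap monalg mpoly.

Set Implicit Arguments.
Unset Strict Implicit.
Unset Printing Implicit Defensive.

Import GRing.Theory.
Local Open Scope ring_scope.
Local Open Scope classical_set_scope.

(* Matrix sizes that must be positive are written n.+1 and b.+1, so that
   square matrices form a nontrivial ring and [horner_mx] and
   [{poly 'M_b.+1}] are available. *)

Section Kronecker.
Variable F : comNzRingType.

(* n_1 * (n_2 * (... * (n_d * 1))) *)
Fixpoint dimprod (d : nat) : ('I_d -> nat) -> nat :=
  match d with
  | 0 => fun=> 1%N
  | d'.+1 => fun n => (n ord0 * dimprod (fun i => n (lift ord0 i)))%N
  end.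

(* w_1 *t (w_2 *t (... *t (w_d *t 1%:M))), where the trailing factor is the
   1 x 1 identity *)
Fixpoint kron (d : nat) : forall n b : 'I_d -> nat,
    (forall i, 'M[F]_(n i, b i)) -> 'M[F]_(dimprod n, dimprod b) :=
  match d with
  | 0 => fun _ _ _ => 1%:M
  | d'.+1 => fun _ _ w => w ord0 *t kron (fun i => w (lift ord0 i))
  end.

End Kronecker.

Section Krylov.
Variable F : fieldType.

(* A pole is an element of F with infinity adjoined: [Some z] is the finite
   pole z and [None] is infinity. *)
Definition pole_poly (xi : seq (option F)) : {poly F} :=
  \prod_(x <- xi) (if x is Some z then 'X - z%:P else 1).

Definition poly_circ (n b : nat) (P : {poly 'M[F]_b.+1}) (A : 'M[F]_n.+1)
    (v : 'M[F]_(n.+1, b.+1)) : 'M[F]_(n.+1, b.+1) :=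
  \sum_(j < size P) A ^+ j *m v *m P`_j.

(* R(A) o v for R = P / Q *)
Definition ratf_circ (n b : nat) (P : {poly 'M[F]_b.+1}) (Q : {poly F})
    (A : 'M[F]_n.+1) (v : 'M[F]_(n.+1, b.+1)) : 'M[F]_(n.+1, b.+1) :=
  invmx (horner_mx A Q) *m poly_circ P A v.

Definition block_krylov (k n b : nat) (A : 'M[F]_n.+1)
    (v : 'M[F]_(n.+1, b.+1)) (xi : k.-tuple (option F)) :
    set 'M[F]_(n.+1, b.+1) :=
  [set w | exists2 P : {poly 'M[F]_b.+1},
     (size P <= k)%N & w = ratf_circ P (pole_poly xi) A v].

Section Multivariate.
Variables (d : nat) (n b : 'I_d -> nat).

Local Notation N := (dimprod (fun i => (n i).+1)).
Local Notation beta := (dimprod (fun i => (b i).+1)).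

Definition tensor_krylov (k : 'I_d -> nat)
    (A : forall i, 'M[F]_((n i).+1)) (C : forall i, 'M[F]_((n i).+1, (b i).+1))
    (xi : forall i, (k i).-tuple (option F)) : set 'M[F]_(N, beta) :=
  let W : set 'M[F]_(N, beta) :=
    [set u | exists2 w : forall i, 'M[F]_((n i).+1, (b i).+1),
       (forall i, block_krylov (A i) (C i) (xi i) (w i)) & u = kron w] in
  [set x | exists (s : nat) (v : 'I_s -> 'M[F]_(N, beta))
                  (G : 'I_s -> 'M[F]_beta),
     (forall j, W (v j)) /\ x = \sum_(j < s) v j *m G j].

(* Polynomials in d variables with beta x beta matrix coefficients: [mpoly]
   requires a nontrivial coefficient ring, and beta is not syntactically a
   successor, so the underlying finitely supported functions from monomials
   to coefficients are used. *)
Definition mxmpoly := {malg 'M[F]_beta['X_{1..d}]}.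

Definition mdeg_le (e : 'I_d -> nat) (P : mxmpoly) : Prop :=
  forall m : 'X_{1..d}, m \in monalg.msupp P -> forall i, (m i <= e i)%N.

Definition mpoly_circ (P : mxmpoly) (A : forall i, 'M[F]_((n i).+1))
    (C : forall i, 'M[F]_((n i).+1, (b i).+1)) : 'M[F]_(N, beta) :=
  \sum_(m <- monalg.msupp P)
    kron (fun i => A i ^+ m i *m C i) *m monalg.mcoeff m P.

(* R(A_1,...,A_d) o (C_1,...,C_d) for R = P / (Q_1(x_1) ... Q_d(x_d)) *)
Definition mratf_circ (P : mxmpoly) (Q : 'I_d -> {poly F})
    (A : forall i, 'M[F]_((n i).+1))
    (C : forall i, 'M[F]_((n i).+1, (b i).+1)) : 'M[F]_(N, beta) :=
  kron (fun i => invmx (horner_mx (A i) (Q i))) *m mpoly_circ P A C.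

End Multivariate.
End Krylov.

(* Main.v *)
(* Both sides consist of the sums of the matrices
   (M_1 A_1^{m_1} C_1 (x) ... (x) M_d A_d^{m_d} C_d) G with m_i < k_i, where
   M_i = Q_i(A_i)^{-1}.  By the mixed product property, such a term is the
   rational function x^m / (Q_1 ... Q_d) with coefficient G; it lies in the
   tensorized space since each factor M_i A_i^{m_i} C_i lies in the i-th Krylov
   space.  Conversely, a Kronecker product of Krylov elements expands
   multilinearly into such terms, the right factors being collected by the
   mixed product property again. *)
Require Import Defs.
From mathcomp Require Import all_boot all_order all_algebra.
From mathcomp Require Import complex classical_sets reals.
From mathcomp Require Import boolp mxtens finmap monalg mpoly.
Import GRing.Theory.
Local Open Scope ring_scope.
Local Open Scope classical_set_scope.

(** Since [T] varies with the index, each value is transported along the equation given by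
    [unliftP]; irrelevance of equality proofs on ordinals then removes the transport. *)
Lemma ord_dep_cons (d : nat) (T : 'I_d.+1 -> Type) (a : T ord0)
    (f : forall j, T (lift ord0 j)) :
  exists2 g : forall i, T i, g ord0 = a & forall j, g (lift ord0 j) = f j.
Proof.
exists (fun i => match unliftP ord0 i with
  | UnliftSome j e => eq_rect_r T (f j) e
  | UnliftNone e => eq_rect_r T a e end); last move=> j.
- by case: unliftP => // e; rewrite (eq_irrelevance e erefl).
- case: unliftP => [j' e|//].
  by have ej := lift_inj e; subst j'; rewrite (eq_irrelevance e erefl).
Qed.

Section KroneckerTheory.
Variable F : comNzRingType.

(** The indices are chosen before [w], so one choice serves all families of matrices and each entry
    is multilinear in [w]. *)
Lemma kron_entry (d : nat) (n b : 'I_d -> nat)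
    (r : 'I_(dimprod n)) (c : 'I_(dimprod b)) :
  exists (ri : forall i, 'I_(n i)) (ci : forall i, 'I_(b i)),
  forall w : forall i, 'M[F]_(n i, b i),
  kron w r c = \prod_i w i (ri i) (ci i).
Proof.
elim: d => [|d IHd] in n b r c *.
  have noord T : 'I_0 -> T by case.
  exists (fun i => noord _ i), (fun i => noord _ i) => w.
  by rewrite big_ord0 !ord1 mxE.
case: (mxtens_indexP r) => r0 r'; case: (mxtens_indexP c) => c0 c'.
have [ri' [ci' E]] := IHd _ _ r' c'.
have [ri ri0 riS] := ord_dep_cons _ (fun i => 'I_(n i)) r0 ri'.
have [ci ci0 ciS] := ord_dep_cons _ (fun i => 'I_(b i)) c0 ci'.
exists ri, ci => w; rewrite /= tensmxE E big_ord_recl ri0 ci0; congr (_ * _).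
by apply: eq_bigr => i _; rewrite riS ciS.
Qed.

Lemma kron_mul (d : nat) (m n p : 'I_d -> nat)
    (X : forall i, 'M[F]_(m i, n i)) (Y : forall i, 'M[F]_(n i, p i)) :
  kron (fun i => X i *m Y i) = kron X *m kron Y.
Proof.
elim: d => [|d IHd] in m n p X Y *; first by rewrite /= mulmx1.
by rewrite /= IHd tensmx_mul.
Qed.

(** Entrywise this is distributivity of a product over sums. *)
Lemma kron_sum (d : nat) (n b : 'I_d -> nat) (J : finType)
    (p : 'I_d -> pred J) (X : forall i, J -> 'M[F]_(n i, b i)) :
  kron (fun i => \sum_(j | p i j) X i j) =
  \sum_(f : {ffun 'I_d -> J} | f \in family p) kron (fun i => X i (f i)).
Proof.
apply/matrixP => r c; have [ri [ci E]] := kron_entry d n b r c.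
rewrite summxE E (eq_bigr _ (fun i _ => summxE _ _ _ _ _)).
by rewrite bigA_distr_big_dep; apply: eq_bigr => f _; rewrite E.
Qed.

End KroneckerTheory.

Section MultivariateCirc.
Variables (F : fieldType) (d : nat) (n b : 'I_d -> nat).
Variables (A : forall i, 'M[F]_((n i).+1)).
Variables (C : forall i, 'M[F]_((n i).+1, (b i).+1)).

Local Notation circ P := (mpoly_circ P A C).

(** Coefficients vanish off the support; enlarging the range lets polynomials with different
    supports be summed over a common one. *)
Lemma mpoly_circEw (D : {fset 'X_{1..d}}) (P : mxmpoly F b) :
  (monalg.msupp P `<=` D)%fset ->
  circ P = \sum_(m <- D)
    kron (fun i => A i ^+ m i *m C i) *m monalg.mcoeff m P.
Proof.
move=> le_PD; apply: big_fset_incl => // m _ /monalg.mcoeff_outdom ->.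
exact: mulmx0.
Qed.

Lemma mpoly_circU (m : 'X_{1..d}) G :
  circ (monalg.mkmalgU m G) = kron (fun i => A i ^+ m i *m C i) *m G.
Proof.
by rewrite (mpoly_circEw _ _ monalg.msuppU_le) big_seq_fset1 monalg.mcoeffUU.
Qed.

Lemma mpoly_circ0 : circ 0 = 0.
Proof. by rewrite /mpoly_circ monalg.msupp0 big_seq_fset0. Qed.

Lemma mpoly_circD (P1 P2 : mxmpoly F b) : circ (P1 + P2) = circ P1 + circ P2.
Proof.
rewrite (mpoly_circEw _ _ (monalg.msuppD_le P1 P2)).
rewrite (mpoly_circEw _ _ (fsubsetUl _ (monalg.msupp P2))).
rewrite (mpoly_circEw _ _ (fsubsetUr (monalg.msupp P1) _)).
by rewrite -big_split; apply: eq_bigr => m _; rewrite monalg.mcoeffD mulmxDr.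
Qed.

Lemma mdeg_le_sum_circ (e : 'I_d -> nat) (q : nat) (L : 'M[F]_(q, _))
    (I : Type) (s : seq I) (p : pred I) X :
  (forall j, p j -> exists2 P : mxmpoly F b, mdeg_le e P & X j = L *m circ P) ->
  exists2 P : mxmpoly F b, mdeg_le e P & \sum_(j <- s | p j) X j = L *m circ P.
Proof.
move=> XP; apply: (big_ind
  (fun x => exists2 P : mxmpoly F b, mdeg_le e P & x = L *m circ P)) => //.
- by exists 0; [move=> m; rewrite monalg.msupp0 | rewrite mpoly_circ0 mulmx0].
- move=> _ _ [P1 deg1 ->] [P2 deg2 ->].
  exists (P1 + P2); last by rewrite mpoly_circD mulmxDr.
  move=> m /(fsubsetP (monalg.msuppD_le P1 P2)).
  by rewrite in_fsetU => /orP[/deg1|/deg2].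
Qed.

(** With [M i] the inverse of $Q_i(A_i)$, this handles one generator of the tensorized space times
    its right coefficient. *)
Lemma kron_poly_circ (e : 'I_d -> nat) (M : forall i, 'M[F]_((n i).+1))
    (P : forall i, {poly 'M[F]_((b i).+1)}) G :
  (forall i, (size (P i) <= (e i).+1)%N) ->
  exists2 P' : mxmpoly F b, mdeg_le e P' &
    kron (fun i => M i *m poly_circ (P i) (A i) (C i)) *m G =
    kron M *m circ P'.
Proof.
(* [kron_sum] needs one index type for all factors, hence the common bound [K] and a filter
   restoring each size. *)
move=> sizeP; pose K := \max_i size (P i).
have widenP i : poly_circ (P i) (A i) (C i) =
    \sum_(j < K | (j < size (P i))%N) A i ^+ j *m C i *m (P i)`_j.
  by rewrite /poly_circ (big_ord_widen _ (fun j => A i ^+ j *m C i *m (P i)`_j)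
    (leq_bigmax (F := fun i => size (P i)) i)).
rewrite kron_mul (functional_extensionality_dep widenP).
rewrite kron_sum -mulmxA mulmx_suml mulmx_sumr.
apply: mdeg_le_sum_circ => f /familyP fP.
(* Each choice [f] of one term per factor contributes a single monomial with exponents [f i]. *)
exists (monalg.mkmalgU [multinom nat_of_ord (f i) | i < d]
         (kron (fun i => (P i)`_(f i)) *m G)).
  move=> m /(fsubsetP monalg.msuppU_le); rewrite inE => /eqP -> i.
  by rewrite mnmE -ltnS (leq_trans (fP i)).
rewrite mpoly_circU kron_mul -(mulmxA _ _ G); congr (_ *m (kron _ *m _)).
by apply: functional_extensionality_dep => i; rewrite mnmE.
Qed.

End MultivariateCirc.

Lemma poly_circXn (F : fieldType) (n b j : nat) (A : 'M[F]_n.+1)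
    (v : 'M[F]_(n.+1, b.+1)) :
  poly_circ 'X^j A v = A ^+ j *m v.
Proof.
rewrite /poly_circ size_polyXn big_ord_recr /= big1 => [|i _].
  by rewrite add0r coefXn eqxx mulmx1.
by rewrite coefXn (ltn_eqF (ltn_ord i)) mulmx0.
Qed.

(* The matrix sizes n_i and b_i of the text are (n i).+1 and (b i).+1. *)
Theorem lemma3p4 (R : realType) (d : nat) (k n b : 'I_d -> nat)
    (A : forall i, 'M[complex R]_((n i).+1))
    (C : forall i, 'M[complex R]_((n i).+1, (b i).+1))
    (xi : forall i, (k i).-tuple (option (complex R)))
    (d_gt0 : (0 < d)%N)
    (k_gt0 : forall i, (0 < k i)%N)
    (poles : forall i (z : complex R),
       Some z \in xi i -> ~~ eigenvalue (A i) z) :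
  tensor_krylov A C xi =
  [set x | exists2 P : mxmpoly (complex R) b,
     mdeg_le (fun i => (k i).-1) P &
     x = mratf_circ P (fun i => pole_poly (xi i)) A C].
Proof.
apply/seteqP; split => x /=.
- case=> s [v [G [vW ->]]]; apply: mdeg_le_sum_circ => j _.
  have [w wW ->] := vW j.
  (* Choice gathers the numerators into one family. *)
  have [P sizeP wE] : exists2 P : forall i, {poly 'M[complex R]_((b i).+1)},
      forall i, (size (P i) <= k i)%N &
      forall i, w i = ratf_circ (P i) (pole_poly (xi i)) (A i) (C i).
    by exists (fun i => s2val (cid2 (wW i))) => i; case: cid2.
  rewrite (functional_extensionality_dep wE); apply: kron_poly_circ => i.
  by rewrite prednK.
- case=> P degP ->; rewrite /mratf_circ /mpoly_circ.
  (* Each monomial of the support gives one generator, with its coefficient as right factor; the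
     default [0%MM] is never reached. *)
  pose S := enum_fset (monalg.msupp P).
  exists (size S).
  exists (fun j => kron (fun i => ratf_circ 'X^(nth 0%MM S j i)
                                    (pole_poly (xi i)) (A i) (C i))).
  exists (fun j => monalg.mcoeff (nth 0%MM S j) P); split=> [j|].
    eexists; last by [].
    move=> i; exists 'X^(nth 0%MM S j i) => //.
    rewrite size_polyXn -(prednK (k_gt0 i)) ltnS; apply: degP.
    exact: mem_nth.
  rewrite (big_nth 0%MM) big_mkord mulmx_sumr; apply: eq_bigr => j _.
  rewrite mulmxA -kron_mul; congr (kron _ *m _).
  by apply: functional_extensionality_dep => i; rewrite /ratf_circ poly_circXn.
Qed.
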